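(* Let $q\ge2$ be an integer, let $\{X_n\}_{n\ge1}$ be a stationary stochastic process with state space $\{0,\ldots,q-1\}$, and let $F$ be the cumulative distribution function of $X=\sum_{n=1}^\infty X_nq^{-n}$. Then there is a constant $c\in[0,1]$ such that, for Lebesgue almost all $x\in[0,1]$, $F'(x)$ exists and equals $c$. Additionally, assume that $F$ is differentiable at $x=(0.x_1x_2\ldots)_q\in[0,1]\setminus\mathbb Q_q$. Then, for any $m\in\mathbb N\cup\{0\}$ and $\xi_1,\ldots,\xi_m\in\{0,\ldots,q-1\}$, $$F'(x)=\lim_{n\to\infty}q^{n+m}p(x_1,\ldots,x_n,\xi_1,\ldots,\xi_m),$$ where for $m=0$ the expression $q^{n+m}p(x_1,\ldots,x_n,\xi_1,\ldots,\xi_m)$ is replaced by $q^np(x_1,\ldots,x_n)$.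
   Context: $\mathbb N=\{1,2,\ldots\}$. Stationary means that $\{X_n\}_{n\ge1}$ and $\{X_n\}_{n\ge2}$ are identically distributed. $F(x)=\mathrm P(X\le x)$ for $x\in\mathbb R$. For digits $x_n\in\{0,\ldots,q-1\}$, $(0.x_1x_2\ldots)_q=\sum_{n=1}^\infty x_nq^{-n}$, and $p(x_1,\ldots,x_n)=\mathrm P(X_1=x_1,\ldots,X_n=x_n)$. $\mathbb Q_q$ is the set of base-$q$ fractions in $(0,1)$, i.e. numbers $(0.x_1\ldots x_n00\ldots)_q$ with $n\in\mathbb N$ and $x_n>0$; every $x\in[0,1]\setminus\mathbb Q_q$ has a unique base-$q$ expansion. *)

(* Defs.v *)
From HB Require Import structures.
From mathcomp Require Import all_boot all_order all_algebra.
From mathcomp Require Import all_classical all_reals all_analysis.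
From mathcomp Require Import measurable_realfun.
Set Implicit Arguments.
Unset Strict Implicit.
Unset Printing Implicit Defensive.
Import Order.TTheory GRing.Theory Num.Theory.
Import numFieldNormedType.Exports.
Local Open Scope classical_set_scope.
Local Open Scope ring_scope.

(* Sequences are indexed from 0: the entry [u n] of [u : nat -> nat] is the
   digit with index n + 1 in the usual notation (0.x_1x_2...)_q. *)

Definition base_value (R : realType) (q : nat) (u : nat -> nat) : R :=
  limn (series (fun n => (u n)%:R / q%:R ^+ n.+1 : R)).

(* [last 0 s > 0] forces [s] to be nonempty; [nth 0 s] pads [s] with zeros. *)
Definition base_fractions (R : realType) (q : nat) : set R :=
  [set x | exists s : seq nat,
     [/\ all (fun a => a < q)%N s, (0 < last 0%N s)%N
       & x = base_value R q (nth 0%N s)]].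

(* [nat -> nat] with the product sigma-algebra, each factor being discrete. *)
Definition path_space := g_sigma_algebraType
  (\bigcup_n preimage_set_system setT (fun u : nat -> nat => u n) measurable).

HB.instance Definition _ := Measurable.on path_space.

Section process.
Context d (T : measurableType d) (R : realType) (P : probability T R).

Definition sample_path (X : nat -> {RV P >-> nat}) : T -> path_space :=
  fun t n => X n t.

Definition identically_distributed (X Y : nat -> {RV P >-> nat}) : Prop :=
  forall A : set path_space, measurable A ->
    pushforward P (sample_path X) A = pushforward P (sample_path Y) A.

Definition stationary (X : nat -> {RV P >-> nat}) : Prop :=
  identically_distributed X (fun n => X n.+1).

Definition word_prob (X : nat -> {RV P >-> nat}) (s : seq nat) : R :=
  fine (P [set t | forall i, (i < size s)%N -> X i t = nth 0%N s i]).

Definition process_value (q : nat) (X : nat -> {RV P >-> nat}) : T -> R :=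
  fun t => base_value R q (fun n => X n t).

Lemma measurable_process_value q X : measurable_fun setT (process_value q X).
Proof.
pose h n t : R := (X n t)%:R / q%:R ^+ n.+1.
have h0 n t : 0 <= h n t by rewrite divr_ge0 ?exprn_ge0 ?ler0n.
have mh n : measurable_fun setT (h n).
  have mf : measurable_fun setT (fun k : nat => k%:R / q%:R ^+ n.+1 : R) by [].
  exact: (measurableT_comp mf (measurable_funPT (X n))).
have -> : process_value q X = fun t => fine (\sum_(0 <= n <oo) (h n t)%:E)%E.
  apply/funext => t; rewrite /process_value /base_value.
  have ndh : nondecreasing_seq (series (h ^~ t)).
    by apply: nondecreasing_series => n _ _; exact: h0.
  have -> : (fun n => \sum_(0 <= k < n) (h k t)%:E)%E = EFin \o series (h ^~ t).
    by apply/funext => n; rewrite /= /series /= sumEFin.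
  have [cv|dv] := pselect (cvgn (series (h ^~ t))); first by rewrite EFin_lim.
  rewrite (dvgP dv) /=.
  have /cvgeryP/cvg_lim -> // : series (h ^~ t) n @[n --> \oo] --> +oo.
  exact: nondecreasing_dvgn_lt.
apply: (measurableT_comp (fine_measurable measurableT)).
apply: ge0_emeasurable_sum => [k t _ _|k _]; first by rewrite lee_fin.
exact/measurable_EFinP.
Qed.

HB.instance Definition _ q X :=
  isMeasurableFun.Build _ _ T R (process_value q X)
    (measurable_process_value q X).

Definition process_cdf (q : nat) (X : nat -> {RV P >-> nat}) : R -> R :=
  fun x => fine (cdf (process_value q X : {RV P >-> R}) x).

End process.

(* Main.v *)
(* Cells of level n are the intervals [k q^-n, (k+1) q^-n], and p n k is the
   probability that the first n digits of X spell k. Put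
   c = inf q^n p n k and r n k = p n k - c q^-n >= 0. Fix e > 0 and call a cell
   dense if it and all the cells containing it satisfy r >= e q^-n. The maximal
   non-dense cells carry r-mass at most e times their length. Stationarity
   writes r m j as the sum of the r (n + m) (k q^m + j) over all k, so if the
   dense cells kept a total length >= d > 0 at all levels, then every cell
   would satisfy q^m r m j >= e d, against the choice of c. So r-mass at most e
   sits on cells of total length at least 1 - e, i.e. r is singular to Lebesgue
   measure. By a Vitali-type maximal inequality for the Lebesgue-Stieltjes
   measure of H(x) = F(x) - c x, the set where the difference quotients of H
   oscillate above a given eta has arbitrarily small outer measure, so H' = 0
   almost everywhere.

   For the limit formula no stationarity is needed: the cell of
   x_1 ... x_n xi_1 ... xi_m lies within q^-n of x and has length q^-(n+m), so
   q^(n+m) times its probability is squeezed between difference quotients of F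
   around x. *)
Require Import Defs.
From HB Require Import structures.
From mathcomp Require Import all_boot all_order all_algebra.
From mathcomp Require Import all_classical all_reals all_analysis.
From mathcomp Require Import finmap measurable_realfun ring lra.
Set Implicit Arguments.
Unset Strict Implicit.
Unset Printing Implicit Defensive.
Import Order.TTheory GRing.Theory Num.Theory.
Import numFieldNormedType.Exports.
Local Open Scope classical_set_scope.
Local Open Scope ring_scope.

(** * Mass and length of non-dense cells *)

Lemma sum_ord_mul (V : nmodType) (a b : nat) (f : nat -> V) :
  \sum_(i < a * b) f i = \sum_(k < a) \sum_(j < b) f (k * b + j)%N.
Proof.
elim: a => [|a IH]; first by rewrite mul0n !big_ord0.
rewrite big_ord_recr /= -IH mulSn addnC big_split_ord /=.
by congr (_ + _); apply: eq_bigr.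
Qed.

Lemma ltn_mulDr (a b k j : nat) :
  (k < a)%N -> (j < b)%N -> (k * b + j < a * b)%N.
Proof.
move=> ka jb; apply: (@leq_trans (k.+1 * b)); last by rewrite leq_mul2r ka orbT.
by rewrite mulSn addnC ltn_add2r.
Qed.

Section cells.
Context (R : realType) (q : nat) (r : nat -> nat -> R).
Hypothesis q_gt0 : (0 < q)%N.
Hypothesis r_ge0 : forall n k, (k < q ^ n)%N -> 0 <= r n k.
Hypothesis r_split : forall n k, (k < q ^ n)%N ->
  r n k = \sum_(j < q) r n.+1 (k * q + j)%N.
Hypothesis r_shift : forall n m j, (j < q ^ m)%N ->
  r m j = \sum_(k < q ^ n) r (n + m)%N (k * q ^ m + j)%N.
Hypothesis r_inf : forall e, 0 < e ->
  exists m j, (j < q ^ m)%N /\ q%:R ^+ m * r m j < e.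

Let qR_gt0 : 0 < q%:R :> R. Proof. by rewrite ltr0n. Qed.
Let qX_gt0 n : 0 < q%:R ^+ n :> R. Proof. exact: exprn_gt0. Qed.

(** The parent of cell [k] is [k %/ q]. Imposing the bound on all ancestors makes the dense cells of
    successive levels nested, so a cell that is newly non-dense has a dense parent. *)
Fixpoint dense (e : R) (n k : nat) : bool :=
  (e <= q%:R ^+ n * r n k) && (if n is n'.+1 then dense e n' (k %/ q) else true).

Lemma dense_le e n k : dense e n k -> e / q%:R ^+ n <= r n k.
Proof. by case: n => [|n] /andP[h _]; rewrite ler_pdivrMr // mulrC. Qed.

Lemma dense_prefix e n m k j : (j < q ^ m)%N ->
  dense e (n + m) (k * q ^ m + j) -> dense e n k.
Proof.
elim: m j => [|m IH] j; first by case: j => //; rewrite !addn0 muln1.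
move=> jq; rewrite addnS /= => /andP[_].
rewrite expnSr mulnA divnMDl //; apply: IH.
by rewrite ltn_divLR // -expnSr.
Qed.

(** Geometrically, the total length of the dense cells of level [n]. *)
Definition dense_freq e n : R := (\sum_(k < q ^ n) (dense e n k)%:R) / q%:R ^+ n.

Lemma dense_freq_ge0 e n : 0 <= dense_freq e n.
Proof. by rewrite divr_ge0 ?sumr_ge0 // ltW. Qed.

Lemma dense_freq_noninc e : nonincreasing_seq (dense_freq e).
Proof.
apply/nonincreasing_seqP => n.
rewrite /dense_freq ler_pdivrMr // exprSr mulrA divfK ?gt_eqF //.
rewrite expnSr (sum_ord_mul _ _ (fun k => (dense e n.+1 k)%:R)) mulr_suml.
rewrite ler_sum // => k _.
rewrite -[X in _ * X%:R]card_ord -sum1_card natr_sum mulr_sumr ler_sum // => j _.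
rewrite mulr1 ler_nat; case: (boolP (dense e n.+1 _)) => // h.
by rewrite (@dense_prefix e n 1 k j) ?addn1 ?expn1.
Qed.

(** By [r_shift], [r m j] is a sum over [k] in which each dense cell [k * q ^ m + j] contributes at
    least [e / q ^ (n + m)]. Below a dense cell [k], such a cell fails to be dense only if it
    belongs to the dense length lost between levels [n] and [n + m]. Charging the whole loss to the
    single index [j] costs the factor [q ^ m]. *)
Lemma dense_lower_bound e n m j : 0 < e -> (j < q ^ m)%N ->
  e * (dense_freq e n - q%:R ^+ m * (dense_freq e n - dense_freq e (n + m)))
    <= q%:R ^+ m * r m j.
Proof.
move=> e0 jq.
have h : \sum_(k < q ^ n) (dense e (n + m) (k * q ^ m + j))%:R <=
    q%:R ^+ (n + m) / e * r m j.
  rewrite (r_shift n jq) mulr_sumr ler_sum // => k _.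
  case: (boolP (dense _ _ _)) => [/dense_le|_].
    by rewrite ler_pdivrMr // => h; rewrite mulrAC ler_pdivlMr // mul1r mulrC.
  apply: mulr_ge0; first by rewrite divr_ge0 ?ltW.
  by rewrite r_ge0 // expnD ltn_mulDr.
have key : q%:R ^+ n * (dense_freq e n -
      q%:R ^+ m * (dense_freq e n - dense_freq e (n + m))) <=
    \sum_(k < q ^ n) (dense e (n + m) (k * q ^ m + j))%:R.
  have -> : q%:R ^+ n * (dense_freq e n -
      q%:R ^+ m * (dense_freq e n - dense_freq e (n + m))) =
    \sum_(k < q ^ n) ((dense e n k)%:R - \sum_(i < q ^ m)
        ((dense e n k)%:R - (dense e (n + m) (k * q ^ m + i))%:R)).
    rewrite sumrB [X in _ = _ - X](eq_bigr (fun k : 'I_(q ^ n) =>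
        (dense e n k)%:R * q%:R ^+ m -
        \sum_(i < q ^ m) (dense e (n + m) (k * q ^ m + i))%:R)); last first.
      by move=> k _; rewrite sumrB sumr_const card_ord -natrX mulr_natr.
    rewrite sumrB -mulr_suml.
    rewrite -(sum_ord_mul _ _ (fun k => (dense e (n + m) k)%:R)) -expnD.
    by rewrite /dense_freq exprD; field; rewrite !gt_eqF.
  rewrite ler_sum // => k _.
  rewrite (bigD1 (Ordinal jq)) //= opprD addrA subKr lerBlDr lerDl sumr_ge0 // => i _.
  rewrite subr_ge0 ler_nat; case: (boolP (dense e (n + m) _)) => // d.
  by rewrite (dense_prefix _ d).
have := le_trans key h.
rewrite exprD -!mulrA ler_pM2l // mulrCA -ler_pdivrMl ?invr_gt0 // invrK.
by rewrite mulrC.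
Qed.

(** For fixed [m] and [j], the loss between levels [n] and [n + m] tends to 0 because the
    frequencies converge to some [l]. Hence [e * l <= q ^ m * r m j] for every cell, which [r_inf]
    forbids when [l > 0]. *)
Lemma dense_freq_small e d : 0 < e -> 0 < d -> exists n, dense_freq e n < d.
Proof.
move=> e0 d0.
have lb : has_lbound (range (dense_freq e)).
  by exists 0 => _ [n _ <-]; exact: dense_freq_ge0.
have cv := nonincreasing_cvgn (@dense_freq_noninc e) lb.
set l := inf _ in cv.
have l0 : l <= 0.
  rewrite leNgt; apply/negP => l0.
  have [m [j [jq]]] := r_inf (mulr_gt0 e0 l0); apply/negP; rewrite -leNgt.
  have cv' : e * (dense_freq e n - q%:R ^+ m *
      (dense_freq e n - dense_freq e (n + m))) @[n --> \oo]
      --> e * (l - q%:R ^+ m * (l - l)).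
    apply: cvgMr; apply: cvgB => //; apply: cvgMr; apply: cvgB => //.
    by have := cv; rewrite -(cvg_shiftn m).
  rewrite subrr mulr0 subr0 in cv'.
  rewrite -(cvg_lim _ cv') //; apply: limr_le; first by apply/cvg_ex; eexists; exact: cv'.
  by apply: nearW => n; exact: dense_lower_bound.
have /cvgrPdist_lt /(_ _ d0) [n _ /(_ n (leqnn n))] := cv.
rewrite ltr_distlC => /andP[_ h]; exists n.
by rewrite (lt_le_trans h) // -[leRHS]add0r lerD2r.
Qed.

Let sum_sparse e n : e * (1 - dense_freq e n) =
  \sum_(k < q ^ n) (~~ dense e n k)%:R * (e / q%:R ^+ n).
Proof.
rewrite -mulr_suml (eq_bigr (fun k : 'I_(q ^ n) => 1 - (dense e n k)%:R)); last first.
  by move=> k _; case: dense; rewrite ?subrr ?subr0.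
rewrite sumrB sumr_const card_ord -natrX /dense_freq natrX.
by field; rewrite gt_eqF.
Qed.

(** Induction on the level: a newly non-dense cell has a dense parent, so it violates the bound
    itself and its mass is below [e] times its length. Inside a cell that was already non-dense,
    mass and length are only redistributed. *)
Lemma sparse_mass e n : 0 <= e ->
  \sum_(k < q ^ n) (~~ dense e n k)%:R * r n k <= e * (1 - dense_freq e n).
Proof.
move=> e0; rewrite sum_sparse; elim: n => [|n IH].
  rewrite ler_sum // => k _; rewrite /= andbT expr0 mul1r divr1 -ltNge.
  by case: ltP => [/ltW|]; rewrite ?mul1r ?mul0r.
rewrite expnSr (sum_ord_mul _ _ (fun k => (~~ dense e n.+1 k)%:R * r n.+1 k)).
rewrite (sum_ord_mul _ _ (fun k => (~~ dense e n.+1 k)%:R * (e / q%:R ^+ n.+1))).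
(* Both sums at level [n.+1] are written as their values at level [n] plus corrections supported on
   the newly non-dense children, which are then compared term by term. *)
have -> : \sum_(k < q ^ n) \sum_(j < q)
      (~~ dense e n.+1 (k * q + j))%:R * (e / q%:R ^+ n.+1) =
    \sum_(k < q ^ n) (~~ dense e n k)%:R * (e / q%:R ^+ n) +
    \sum_(k < q ^ n) \sum_(j < q) ((~~ dense e n.+1 (k * q + j))%:R -
      (~~ dense e n k)%:R) * (e / q%:R ^+ n.+1).
  rewrite -big_split; apply: eq_bigr => k _ /=.
  rewrite -2!mulr_suml sumrB sumr_const card_ord -(mulr_natr _ q) exprSr.
  by field; rewrite mul1r !gt_eqF.
have -> : \sum_(k < q ^ n) \sum_(j < q)
      (~~ dense e n.+1 (k * q + j))%:R * r n.+1 (k * q + j)%N =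
    \sum_(k < q ^ n) (~~ dense e n k)%:R * r n k +
    \sum_(k < q ^ n) \sum_(j < q) ((~~ dense e n.+1 (k * q + j))%:R -
      (~~ dense e n k)%:R) * r n.+1 (k * q + j)%N.
  rewrite -big_split; apply: eq_bigr => k _ /=; rewrite r_split // mulr_sumr.
  by rewrite -big_split; apply: eq_bigr => j _; rewrite /= -mulrDl addrC subrK.
rewrite lerD // ler_sum // => k _; rewrite ler_sum // => j _ /=.
rewrite divnMDl // divn_small // addn0.
case: (dense e n k); rewrite ?andbT ?andbF ?subrr ?mul0r // -ltNge subr0.
case: ltP => [|_]; rewrite ?mul1r ?mul0r // => h.
by rewrite ler_pdivlMr // mulrC ltW.
Qed.

Lemma sparse_cells e : 0 < e -> exists n (B : pred nat),
  \sum_(k < q ^ n) (B k)%:R * r n k <= e /\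
  \sum_(k < q ^ n) (~~ B k)%:R / q%:R ^+ n <= e.
Proof.
move=> e0; have [n h] := dense_freq_small e0 e0.
exists n, (fun k => ~~ dense e n k); split.
  apply: (le_trans (sparse_mass n (ltW e0))).
  by apply: ler_piMr; rewrite ?gerBl ?dense_freq_ge0 // ltW.
rewrite -mulr_suml; under eq_bigr do rewrite negbK.
exact: ltW.
Qed.

End cells.

(** * A maximal inequality for Lebesgue-Stieltjes measures *)

Lemma stieltjes_measure_ocitv (R : realType) (H : cumulative R R) (a b : R) :
  a <= b -> lebesgue_stieltjes_measure H `]a, b]%classic = (H b - H a)%:E.
Proof.
move=> ab; rewrite /lebesgue_stieltjes_measure /measure_extension /=.
by rewrite measurable_mu_extE /= ?wlength_itv_bnd //; exact: is_ocitv.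
Qed.

Section steep.
Context (R : realType) (H : cumulative R R) (c : R) (U : set R).

(** Half-open intervals have [H]-mass exactly [H I.2 - H I.1]; [steep_part] uses the open ones, as a
    compactness argument needs. *)
Definition steep (I : R * R) : Prop :=
  [/\ I.1 < I.2, `]I.1, I.2] `<=` U & c * (I.2 - I.1) <= H I.2 - H I.1].

Definition steep_part : set R := \bigcup_(I in steep) `]I.1, I.2[%classic.

Lemma open_steep_part : open steep_part.
Proof. by apply: bigcup_open => I _; exact: interval_open. Qed.

Let mid (I : R * R) := (I.1 + I.2) / 2.
Let rad (I : R * R) := (I.2 - I.1) / 2.

Let ballE (I : R * R) : ball (mid I) (rad I) = `]I.1, I.2[%classic.
Proof.
have e1 : mid I - rad I = I.1 by rewrite /mid /rad; field.
have e2 : mid I + rad I = I.2 by rewrite /mid /rad; field.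
by rewrite ball_itv e1 e2.
Qed.

(** By inner regularity it suffices to bound compact subsets. Such a set is covered by finitely many
    steep intervals, and the finite Vitali lemma extracts disjoint ones whose threefold enlargements
    still cover. Their lengths are at most their [H]-masses divided by [c], and these masses add up
    inside [U]. *)
Lemma steep_part_le : 0 < c -> measurable U ->
  (c%:E * lebesgue_measure steep_part <= 3%:E * lebesgue_stieltjes_measure H U)%E.
Proof.
move=> c0 mU; have mG := open_measurable open_steep_part.
rewrite lebesgue_regularity_inner_sup // -lee_pdivlMl //.
apply: ge_ereal_sup => /= x /= [K [cK KG <-{x}]].
have [D Dsub Kcover] : finite_subset_cover steep
    (fun I => ball (mid I) (rad I)) K.
  move: cK; rewrite compact_cover; apply => [I _|x /KG [I sI xI]].
    exact: ball_open.
  by exists I => //; rewrite ballE.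
(* The covering lemma wants a nonempty ball at every index, hence the default [ball 0 1] at
   degenerate pairs. *)
pose B (I : R * R) := if I.1 < I.2 then ball (mid I) (rad I) else ball 0 1 : set R.
have is_ballB I : is_ball (B I) by rewrite /B; case: ifP => _; exact: is_ball_ball.
have B0 I : B I !=set0.
  rewrite /B; case: ltP => [I12|_]; last by exists 0; exact: ballxx.
  by exists (mid I); apply: ballxx; rewrite divr_gt0 // subr_gt0.
have Bball I : exists x r, 0 < r /\ B I = ball x r.
  rewrite /B; case: ltP => [I12|_]; last by exists 0, 1.
  by exists (mid I), (rad I); rewrite divr_gt0 // subr_gt0.
have KDB : K `<=` cover [set` D] B.
  move=> x /Kcover [I DI Ix]; exists I => //=.
  by have /set_mem [I12 _ _] := Dsub I DI; rewrite /B I12.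
have [E [uE ED tEB DE]] := @vitali_lemma_finite_cover _ _ B is_ballB B0 D.
have {}DE := subset_trans KDB DE.
have sE I : I \in E -> steep I by move=> /ED /Dsub /set_mem.
have BE I : I \in E -> B I = `]I.1, I.2[%classic.
  by move=> /sE [I12 _ _]; rewrite /B I12 ballE.
have lamE I : I \in E -> lebesgue_measure (B I) = (I.2 - I.1)%:E.
  move=> IE; have [I12 _ _] := sE I IE.
  by rewrite BE // lebesgue_measure_itv /= lte_fin I12.
have KE : (lebesgue_measure K <= 3%:E * \sum_(I <- E) lebesgue_measure (B I))%E.
  apply: (le_trans (@content_subadditive _ _ _ lebesgue_measure K
      (fun i => 3 *` B (nth (0, 0) E i)) (size E) _ _ _)) => //.
  - move=> k ?; have [x [r [r0 ->]]] := Bball (nth (0, 0) E k).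
    by rewrite scale_ballE //; exact: measurable_ball.
  - by apply: closed_measurable; apply: compact_closed => //; exact: Rhausdorff.
  - apply: (subset_trans DE); rewrite /cover bigcup_seq.
    by rewrite (big_nth (0, 0)) //= big_mkord.
  - rewrite ge0_sume_distrr //= (big_nth (0, 0)) big_mkord; apply: lee_sum => i _.
    have [x [r [r0 ->]]] := Bball (nth (0, 0) E i).
    rewrite scale_ballE // !lebesgue_measure_ball ?mulr_ge0 ?(ltW r0) //.
    by rewrite -mulrnAr EFinM.
rewrite lee_pdivlMl //.
rewrite (le_trans (lee_wpmul2l _ KE)) ?lee_fin ?(ltW c0) // muleCA.
rewrite lee_wpmul2l // ?lee_fin // ge0_sume_distrr //.
(* Only the open intervals are known to be disjoint. If two of the half-open ones meet, their
   intersection is a nondegenerate interval, and its midpoint lies in both open intervals. *)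
have trivE : trivIset [set` E] (fun I : R * R => `]I.1, I.2]%classic).
  move=> I J /= IE JE [x [/=]]; rewrite !in_itv /= => /andP[a1 a2] /andP[b1 b2].
  apply: tEB => //; rewrite !BE //.
  exists ((Num.max I.1 J.1 + Num.min I.2 J.2) / 2).
  have : Num.max I.1 J.1 < Num.min I.2 J.2.
    have [I12 _ _] := sE I IE; have [J12 _ _] := sE J JE.
    by rewrite gt_max !lt_min I12 J12 (lt_le_trans a1 b2) (lt_le_trans b1 a2).
  move=> h; have : Num.max I.1 J.1 >= I.1 /\ Num.max I.1 J.1 >= J.1.
    by rewrite !le_max !lexx orbT.
  have : Num.min I.2 J.2 <= I.2 /\ Num.min I.2 J.2 <= J.2.
    by rewrite !ge_min !lexx orbT.
  move=> [? ?] [? ?]; split; rewrite /= in_itv /=; apply/andP; split; lra.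
have mI I : measurable (`]I.1, I.2]%classic : set R) by exact: measurable_itv.
apply: (@le_trans _ _ (\sum_(I <- E) lebesgue_stieltjes_measure H `]I.1, I.2]%classic)%E).
  rewrite [leLHS]big_seq [leRHS]big_seq; apply: lee_sum => I IE.
  have [I12 _ le] := sE I IE.
  by rewrite lamE // stieltjes_measure_ocitv ?(ltW I12) // -EFinM lee_fin.
rewrite fsbig_seq // -measure_fin_bigcup //.
apply: le_measure; [apply: mem_set|exact: mem_set|].
  exact: fin_bigcup_measurable.
by move=> x [I /= IE xI]; have [_ + _] := sE I IE; exact.
Qed.

End steep.

(** * Digit prefixes and the probability of cells *)

Section prefix.
Context (R : realType) (q : nat).
Hypothesis q_gt0 : (0 < q)%N.
Implicit Types u v : nat -> nat.

(** The index of the cell of level [n] spelled by the first [n] digits of [u]. *)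
Fixpoint prefix_value u n : nat :=
  if n is n'.+1 then (prefix_value u n' * q + u n')%N else 0%N.

Lemma prefix_value_lt u n : (forall i, (u i < q)%N) -> (prefix_value u n < q ^ n)%N.
Proof.
move=> uq; elim: n => [//|n IH] /=.
apply: (@leq_trans ((prefix_value u n).+1 * q)).
  by rewrite mulSn addnC ltn_add2r.
by rewrite expnSr leq_mul2r IH orbT.
Qed.

Lemma prefix_valueD u n m : prefix_value u (n + m) =
  (prefix_value u n * q ^ m + prefix_value (fun i => u (n + i)%N) m)%N.
Proof.
elim: m => [|m IH]; first by rewrite addn0 muln1 addn0.
by rewrite addnS /= IH mulnDl -mulnA -expnSr addnA.
Qed.

Lemma prefix_value_inj u v n : (forall i, (u i < q)%N) -> (forall i, (v i < q)%N) ->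
  prefix_value u n = prefix_value v n <-> (forall i, (i < n)%N -> u i = v i).
Proof.
move=> uq vq; elim: n => [//|n IH] /=; split => [e i|e].
  have eu : u n = v n.
    by have := congr1 (modn^~ q) e; rewrite /= !modnMDl !modn_small.
  rewrite ltnS leq_eqVlt => /predU1P[->//|].
  apply: IH.1; have := congr1 (divn^~ q) e.
  by rewrite /= !divnMDl // !divn_small // !addn0.
by rewrite (IH.2 (fun i h => e i (ltnW h))) e.
Qed.

Let qX_gt0 n : 0 < q%:R ^+ n :> R. Proof. by rewrite exprn_gt0 ?ltr0n. Qed.

Lemma base_value_series u n :
  series (fun i => (u i)%:R / q%:R ^+ i.+1 : R) n = (prefix_value u n)%:R / q%:R ^+ n.
Proof.
elim: n => [|n IH]; first by rewrite /series /= big_geq // mul0r.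
rewrite seriesS IH /= natrD natrM exprSr.
have := qX_gt0 n; have := qX_gt0 1; rewrite expr1 => /gt_eqF h1 /gt_eqF h2.
by field; rewrite h1 h2.
Qed.

(** The digits after the first [n] contribute at most one cell length, attained when they all equal
    [q - 1]. The same bound makes the series converge, so that [limn] is a genuine limit. *)
Lemma base_value_bounds u n : (forall i, (u i < q)%N) ->
  (prefix_value u n)%:R / q%:R ^+ n <= base_value R q u <=
    (prefix_value u n).+1%:R / q%:R ^+ n.
Proof.
move=> uq; pose S := series (fun i => (u i)%:R / q%:R ^+ i.+1 : R).
have ndS : nondecreasing_seq S.
  by apply: nondecreasing_series => i _ _; rewrite divr_ge0 // ltW.
have ubS m : S m <= (prefix_value u n).+1%:R / q%:R ^+ n.
  apply: (le_trans (ndS _ _ (leq_addl n m))).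
  rewrite /S base_value_series prefix_valueD exprD ler_pdivrMr ?mulr_gt0 //.
  rewrite mulrA divfK ?gt_eqF // -natrX -natrM ler_nat mulSn addnC leq_add2r.
  by rewrite ltnW // prefix_value_lt.
have cS : cvgn S.
  apply: nondecreasing_is_cvgn => //.
  by exists ((prefix_value u n).+1%:R / q%:R ^+ n) => _ [m _ <-].
apply/andP; split; first by rewrite -base_value_series; exact: nondecreasing_cvgn_le.
by apply: limr_le => //; apply: nearW.
Qed.

End prefix.

Section fibers.
Context d (T : measurableType d).

Lemma measurable_fiber (g : T -> nat) (k : nat) :
  measurable_fun setT g -> measurable [set t | g t = k].
Proof.
by move=> mg; rewrite -[X in measurable X]setTI; exact: (mg measurableT [set k]).
Qed.

Lemma measurable_prefix_value (q n : nat) (u : nat -> T -> nat) :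
  (forall i, measurable_fun setT (u i)) ->
  measurable_fun setT (fun t => prefix_value q (u^~ t) n).
Proof.
move=> mu; elim: n => [|n IH]; first exact: measurable_cst.
apply: measurable_fun_addn => //.
have mf : measurable_fun setT (fun k : nat => (k * q)%N) by [].
exact: (measurableT_comp mf IH).
Qed.

End fibers.

(** * Cell probabilities, stationarity, and increments of the distribution function *)

Section cell_probability.
Context d (T : measurableType d) (R : realType) (P : probability T R).

Lemma fine_probability_le (A B : set T) : measurable A -> measurable B ->
  A `<=` B -> fine (P A) <= fine (P B).
Proof.
move=> mA mB AB; apply: fine_le; rewrite ?fin_num_measure //.
by apply: le_measure => //; exact: mem_set.
Qed.

Lemma fine_probability_partition (A : set T) (N : nat) (g : T -> nat) :
  measurable A -> measurable_fun setT g -> (forall t, A t -> (g t < N)%N) ->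
  fine (P A) = \sum_(k < N) fine (P (A `&` g @^-1` [set k : nat])).
Proof.
move=> mA mg gN.
have mAg k : measurable (A `&` g @^-1` [set k]).
  by apply: measurableI => //; exact: measurable_fiber.
rewrite [X in P X](_ : _ = \big[setU/set0]_(k < N) (A `&` g @^-1` [set k : nat])).
  rewrite measure_bigsetU_ord // -?sum_fine // => [k _|].
    by rewrite fin_num_measure.
  by move=> i j _ _ [t [[_ /= e1] [_ /= e2]]]; apply/val_inj; rewrite /= -e1 e2.
rewrite -(bigcup_mkord N (fun k => A `&` g @^-1` [set k])).
apply/seteqP; split => [t At|t [k _ []]//].
by exists (g t) => //=; exact: gN.
Qed.

Variables (q : nat) (X : nat -> {RV P >-> nat}).
Hypothesis q_gt0 : (0 < q)%N.
Hypothesis X_digit : forall n t, (X n t < q)%N.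

(** Defined by the digits and not by the position of the value: the cells of one level give disjoint
    events although neighbouring closed cells share an endpoint. *)
Definition cell_event (n k : nat) : set T := [set t | prefix_value q (X^~ t) n = k].

Definition cell_prob (n k : nat) : R := fine (P (cell_event n k)).

Lemma measurable_cell_event n k : measurable (cell_event n k).
Proof.
apply: measurable_fiber.
exact: (measurable_prefix_value q n (fun i => measurable_funPT (X i))).
Qed.

Lemma cell_prob_ge0 n k : 0 <= cell_prob n k.
Proof. by rewrite fine_ge0. Qed.

Lemma cell_prob00 : cell_prob 0 0 = 1.
Proof.
rewrite /cell_prob [X in P X](_ : _ = setT) ?probability_setT //.
by apply/seteqP; split.
Qed.

Lemma cell_prob_split n k :
  cell_prob n k = \sum_(j < q) cell_prob n.+1 (k * q + j)%N.
Proof.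
rewrite /cell_prob (fine_probability_partition (N := q) (measurable_cell_event n k)
  (measurable_funPT (X n))) => [|t _]; last exact: X_digit.
apply: eq_bigr => j _; congr (fine (P _)); apply/seteqP; split => t /=.
  by rewrite /cell_event /= => -[-> ->].
rewrite /cell_event /= => e; split.
  by have := congr1 (divn^~ q) e; rewrite /= !divnMDl // !divn_small // !addn0.
by have := congr1 (modn^~ q) e; rewrite /= !modnMDl !modn_small.
Qed.

Hypothesis X_stat : stationary X.

Lemma measurable_coordinate (n : nat) :
  measurable_fun setT (fun u : path_space => u n).
Proof.
move=> _ B mB; apply: sub_sigma_algebra.
by exists n => //; exists B.
Qed.

Lemma shifted_cell_prob n m k :
  fine (P [set t | prefix_value q (fun i => X (n + i)%N t) m = k]) = cell_prob m k.
Proof.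
elim: n => [//|n <-].
(* Stationarity applied to this event moves the window of digits from [n] to [n.+1]. *)
pose A := [set u : path_space | prefix_value q (fun i => u (n + i)%N) m = k].
have mA : measurable A.
  apply: measurable_fiber.
  exact: (measurable_prefix_value q m (fun i => measurable_coordinate (n + i)%N)).
have := X_stat mA; rewrite /pushforward /sample_path /preimage /A /= => e.
by rewrite [in RHS]e.
Qed.

(** The window of [m] digits after the first [n] has the law of the first [m] digits; the sum then
    splits according to those first [n] digits. *)
Lemma cell_prob_shift n m j : (j < q ^ m)%N ->
  cell_prob m j = \sum_(k < q ^ n) cell_prob (n + m)%N (k * q ^ m + j)%N.
Proof.
move=> jq; rewrite -(shifted_cell_prob n).
rewrite (@fine_probability_partition _ (q ^ n) (fun t => prefix_value q (X^~ t) n)).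
- apply: eq_bigr => k _; congr (fine (P _)); apply/seteqP; split => t.
    by rewrite /cell_event /= prefix_valueD => -[-> ->].
  have h : (prefix_value q (fun i => X (n + i)%N t) m < q ^ m)%N.
    exact: prefix_value_lt.
  rewrite /cell_event /= prefix_valueD => e; split.
    by have := congr1 (modn^~ (q ^ m)%N) e; rewrite /= !modnMDl !modn_small.
  have := congr1 (divn^~ (q ^ m)%N) e.
  by rewrite /= !divnMDl ?expn_gt0 ?q_gt0 // !divn_small // !addn0.
- apply: measurable_fiber.
  exact: (measurable_prefix_value q m (fun i => measurable_funPT (X (n + i)%N))).
- exact: (measurable_prefix_value q n (fun i => measurable_funPT (X i))).
- by move=> t _; exact: prefix_value_lt.
Qed.

Lemma word_probE (s : seq nat) : all (fun a => (a < q)%N) s ->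
  word_prob X s = cell_prob (size s) (prefix_value q (nth 0%N s) (size s)).
Proof.
move=> /all_nthP sq; congr (fine (P _)).
have s_lt i : (nth 0 s i < q)%N.
  by case: (ltnP i (size s)) => [/(sq 0%N)//|h]; rewrite nth_default.
by apply/seteqP; split => t; rewrite /cell_event /=;
  move/(prefix_value_inj q_gt0 (size s) (X_digit^~ t) s_lt).
Qed.

Local Notation F := (process_cdf q X).
Let XR : {RV P >-> R} := process_value q X.

Let measurable_oc (x y : R) : measurable (XR @^-1` `]x, y]).
Proof. by rewrite -[X in measurable X]setTI; exact: measurable_funPT. Qed.

Let measurable_le (x : R) : measurable (XR @^-1` `]-oo, x]).
Proof. by rewrite -[X in measurable X]setTI; exact: measurable_funPT. Qed.

Lemma process_cdfB x y : x <= y ->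
  F y - F x = fine (P (process_value q X @^-1` `]x, y])).
Proof.
move=> xy; rewrite /process_cdf /cdf /distribution /pushforward.
have -> : `]-oo, y]%classic = `]-oo, x] `|` `]x, y] :> set R.
  by rewrite -itv_bndbnd_setU // bnd_simp.
rewrite preimage_setU measureU //.
- rewrite fineD; first by rewrite addrC addKr.
    by apply: fin_num_measure; exact: measurable_le.
  by apply: fin_num_measure; exact: measurable_oc.
- exact: measurable_le.
- exact: measurable_oc.
- apply/seteqP; split => // t [/=]; rewrite !in_itv /= => h1 /andP[h2 _].
  by have := le_lt_trans h1 h2; rewrite ltxx.
Qed.

Let cellX n t : (prefix_value q (X^~ t) n)%:R / q%:R ^+ n <= process_value q X t <=
  (prefix_value q (X^~ t) n).+1%:R / q%:R ^+ n.
Proof. exact: base_value_bounds. Qed.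

Let qX_gt0 n : 0 < q%:R ^+ n :> R. Proof. by rewrite exprn_gt0 ?ltr0n. Qed.

(** The closed cell lies in []x, y]]. The left inequality is strict because the value may have an
    atom at the left end of the cell. *)
Lemma cell_prob_le_cdfB n (k : nat) x y :
  x < k%:R / q%:R ^+ n -> k.+1%:R / q%:R ^+ n <= y -> cell_prob n k <= F y - F x.
Proof.
move=> xk ky; rewrite process_cdfB; last first.
  apply: (le_trans (ltW xk)); apply: le_trans ky.
  by rewrite ler_pM2r ?invr_gt0 // ler_nat.
apply: fine_probability_le; [exact: measurable_cell_event|exact: measurable_oc|].
move=> t /= tk; have := cellX n t; rewrite tk in_itv /= => /andP[h1 h2].
by rewrite (lt_le_trans xk h1) (le_trans h2).
Qed.

(** A value strictly inside the cell determines its first [n] digits. The right inequality is strict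
    because the right end of the cell is also the left end of the next one. *)
Lemma cdfB_le_cell_prob n (k : nat) x y :
  k%:R / q%:R ^+ n <= x -> x <= y -> y < k.+1%:R / q%:R ^+ n ->
  F y - F x <= cell_prob n k.
Proof.
move=> kx xy yk; rewrite process_cdfB //.
apply: fine_probability_le; [exact: measurable_oc|exact: measurable_cell_event|].
move=> t /=; rewrite in_itv /= => /andP[h1 h2].
have /andP[h3 h4] := cellX n t.
have := le_lt_trans h3 (le_lt_trans h2 yk).
have := lt_le_trans (le_lt_trans kx h1) h4.
rewrite !ltr_pM2r ?invr_gt0 // !ltr_nat !ltnS => a b.
by apply/eqP; rewrite eqn_leq a b.
Qed.

(** The block of cells is treated at once: [cell_prob_le_cdfB] cell by cell would need overlapping
    intervals. *)
Lemma sum_cell_prob_le_cdfB n (i j : nat) x y : (j <= q ^ n)%N ->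
  x <= y -> x < i%:R / q%:R ^+ n -> j%:R / q%:R ^+ n <= y ->
  \sum_(i <= k < j) cell_prob n k <= F y - F x.
Proof.
move=> jq xy xi jy; rewrite process_cdfB //.
rewrite (@fine_probability_partition _ (q ^ n) (fun t => prefix_value q (X^~ t) n)).
- rewrite -(big_mkord xpredT (fun k => fine (P (process_value q X @^-1` `]x, y]
    `&` (fun t => prefix_value q (X ^~ t) n) @^-1` [set k])))).
  have [ij|/ltnW ji] := leqP i j; last first.
    by rewrite [leLHS]big_geq // sumr_ge0 // => k _; rewrite fine_ge0.
  rewrite [leRHS](big_cat_nat (n := j)) //= [X in _ <= X + _](big_cat_nat (n := i)) //=.
  apply: ler_wpDr; first by apply: sumr_ge0 => k _; rewrite fine_ge0.
  apply: ler_wpDl; first by apply: sumr_ge0 => k _; rewrite fine_ge0.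
  apply: ler_sum_nat => k /andP[ik kj].
  apply: fine_probability_le; first exact: measurable_cell_event.
    apply: measurableI; first exact: measurable_oc.
    exact: measurable_cell_event.
  move=> t /= tk; split => //=; have := cellX n t; rewrite tk in_itv /= => /andP[h1 h2].
  rewrite (lt_le_trans xi) /=.
    apply: (le_trans h2); apply: le_trans jy.
    by rewrite ler_pM2r ?invr_gt0 // ler_nat.
  by apply: le_trans h1; rewrite ler_pM2r ?invr_gt0 // ler_nat.
- exact: measurable_oc.
- exact: (measurable_prefix_value q n (fun i => measurable_funPT (X i))).
- by move=> t _; exact: prefix_value_lt.
Qed.

End cell_probability.

(** * The derivative as a limit of cell densities *)

Lemma derivable_linear_approx (R : realType) (f : R -> R) (x e : R) :
  derivable f x 1 -> 0 < e -> exists2 r : R, 0 < r &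
  forall y, `|y - x| < r -> `|f y - f x - derive1 f x * (y - x)| <= e * `|y - x|.
Proof.
move=> df e0.
have : h^-1 *: (f (h + x) - f x) @[h --> 0^'] --> derive1 f x.
  have := df; rewrite /derivable derive1E /derive => /cvg_ex[l].
  under eq_fun do rewrite scaler1; move=> cl; rewrite (cvg_lim _ cl) //.
move=> /cvgrPdist_le /(_ _ e0) [r /= r0 hr].
exists r => // y yr; have [->|yx] := eqVneq y x.
  by rewrite !subrr mulr0 subrr normr0 mulr0.
have yx0 : y - x != 0 by rewrite subr_eq0.
have := hr (y - x); rewrite /= sub0r normrN subrK => /(_ yr yx0).
rewrite -(ler_pM2r (x := `|y - x|)) ?normr_gt0 // -normrM => h.
apply: le_trans h; rewrite -normrN le_eqVlt; apply/orP; left; apply/eqP.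
by congr (`|_|); rewrite /GRing.scale /=; field.
Qed.

Section limit.
Context d (T : measurableType d) (R : realType) (P : probability T R).
Variables (q : nat) (X : nat -> {RV P >-> nat}).
Hypothesis q_gt1 : (1 < q)%N.
Hypothesis X_digit : forall n t, (X n t < q)%N.
Local Notation F := (process_cdf q X).
Let q_gt0 : (0 < q)%N. Proof. exact: ltnW. Qed.
Let qX_gt0 n : 0 < q%:R ^+ n :> R. Proof. by rewrite exprn_gt0 ?ltr0n. Qed.

Lemma cell_size_cvg0 : (q%:R ^+ n)^-1 @[n --> \oo] --> (0 : R).
Proof.
under eq_fun do rewrite -exprVn.
apply: cvg_expr; rewrite ger0_norm ?invr_ge0 ?ler0n //.
by rewrite invf_lt1 ?ltr0n // ltr1n.
Qed.

(** The cell probability lies between the increments of [F] over []a, b - dl]] and []a - dl, b]],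
    where [a] and [b] are the ends of the cell. The linear approximation of [F] at [x] evaluates
    both. *)
Lemma cell_density_approx (e r x Q : R) (N k : nat) :
  (forall y, `|y - x| < r -> `|F y - F x - derive1 F x * (y - x)| <= e * `|y - x|) ->
  0 < e <= 1 -> 3 * Q < r ->
  x - Q <= k%:R / q%:R ^+ N -> k.+1%:R / q%:R ^+ N <= x + Q ->
  `|derive1 F x - q%:R ^+ N * cell_prob q X N k| <=
    e * (`|derive1 F x| + 2 * (q%:R ^+ N * Q) + 2).
Proof.
move=> dF /andP[e0 e1] Qr ak bk; set l := derive1 F x in dF *.
set a := k%:R / _ in ak; set b := k.+1%:R / _ in bk; set M := q%:R ^+ N.
have M0 : 0 < M by exact: qX_gt0.
have abE : b = a + M^-1 by rewrite /a /b -natr1 mulrDl mul1r.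
(* A shift by the fraction [e] of the cell length avoids atoms at the ends. It is at most the cell
   length, hence at most [2 * Q], so all points used stay within [3 * Q < r] of [x]. *)
pose dl := e / M.
have dl0 : 0 < dl by rewrite divr_gt0.
have dlM : dl <= M^-1 by rewrite /dl ler_piMl // invr_ge0 ltW.
have M'0 : 0 < M^-1 by rewrite invr_gt0.
have p1 : cell_prob q X N k <= F b - F (a - dl).
  by apply: cell_prob_le_cdfB => //; rewrite ltrBlDr ltrDl.
have p2 : F (b - dl) - F a <= cell_prob q X N k.
  by apply: cdfB_le_cell_prob => //; [lra | rewrite ltrBlDr ltrDl].
have near_ y : x - (Q + dl) <= y -> y <= x + Q ->
    `|F y - F x - l * (y - x)| <= e * (Q + dl).
  move=> h1 h2; have yx : `|y - x| <= Q + dl by rewrite ler_norml; lra.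
  apply: (le_trans (dF _ _)); first by apply: (le_lt_trans yx); lra.
  by rewrite ler_pM2l.
have lM : `|l * e| <= `|l| * e by rewrite normrM (ger0_norm (ltW e0)).
have e2 : e * e <= e by rewrite ler_piMr // ltW.
have MM : M * M^-1 = 1 by rewrite divff // gt_eqF.
have Mdl : M * dl = e by rewrite /dl mulrC divfK // gt_eqF.
have := near_ b; rewrite ler_norml => /(_ ltac:(lra) ltac:(lra)) /andP[b1 b2].
have := near_ a; rewrite ler_norml => /(_ ltac:(lra) ltac:(lra)) /andP[a1 a2].
have := near_ (b - dl); rewrite ler_norml => /(_ ltac:(lra) ltac:(lra)) /andP[bd1 bd2].
have := near_ (a - dl); rewrite ler_norml => /(_ ltac:(lra) ltac:(lra)) /andP[ad1 ad2].
have up : cell_prob q X N k <= l * (M^-1 + dl) + 2 * (e * (Q + dl)).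
  apply: (le_trans p1); rewrite abE in b2 *.
  have -> : l * (M^-1 + dl) = l * (a + M^-1 - x) - l * (a - dl - x) by ring.
  lra.
have lo : l * (M^-1 - dl) - 2 * (e * (Q + dl)) <= cell_prob q X N k.
  apply: (le_trans _ p2); rewrite abE in bd1 *.
  have -> : l * (M^-1 - dl) = l * (a + M^-1 - dl - x) - l * (a - x) by ring.
  lra.
have {}up : M * cell_prob q X N k <= l + l * e + 2 * (e * (M * Q + e)).
  apply: (le_trans (_ : _ <= M * (l * (M^-1 + dl) + 2 * (e * (Q + dl))))).
    by rewrite ler_pM2l.
  have -> : M * (l * (M^-1 + dl) + 2 * (e * (Q + dl))) =
      l * (M * M^-1) + l * (M * dl) + 2 * (e * (M * Q + M * dl)) by ring.
  by rewrite MM Mdl mulr1.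
have {}lo : l - l * e - 2 * (e * (M * Q + e)) <= M * cell_prob q X N k.
  apply: (le_trans (_ : _ <= M * (l * (M^-1 - dl) - 2 * (e * (Q + dl))))); last first.
    by rewrite ler_pM2l.
  have -> : M * (l * (M^-1 - dl) - 2 * (e * (Q + dl))) =
      l * (M * M^-1) - l * (M * dl) - 2 * (e * (M * Q + M * dl)) by ring.
  by rewrite MM Mdl mulr1.
move: lM; rewrite ler_norml => /andP[lM1 lM2].
rewrite ler_norml; apply/andP; split; nra.
Qed.

Lemma cell_density_cvg (x : R) (u : nat -> nat) (m j : nat) :
  (forall n, (u n < q)%N) -> x = base_value R q u -> (j < q ^ m)%N ->
  derivable F x 1 ->
  q%:R ^+ (n + m) * cell_prob q X (n + m)%N (prefix_value q u n * q ^ m + j)%N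
    @[n --> \oo] --> derive1 F x.
Proof.
move=> uq xu jq dF; apply/cvgrPdist_le => e e0.
(* The error factor of [cell_density_approx] for [Q] equal to [q ^- n]: there [q ^ (n + m) * Q] is
   [q ^ m], independent of [n]. *)
pose C : R := `|derive1 F x| + 2 * q%:R ^+ m + 2.
have C0 : 0 < C by rewrite ltr_wpDl // addr_ge0 // mulr_ge0 // ltW.
pose e' := Num.min 1 (e / C).
have e'0 : 0 < e' by rewrite lt_min ltr01 divr_gt0.
have e'1 : e' <= 1 by rewrite ge_min lexx.
have e'C : e' * C <= e by rewrite -ler_pdivlMr // ge_min lexx orbT.
have [r r0 hr] := derivable_linear_approx dF e'0.
have r3 : 0 < r / 3 by rewrite divr_gt0.
have /cvgrPdist_lt /(_ _ r3) := cell_size_cvg0; apply: filterS => n.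
rewrite sub0r normrN gtr0_norm ?invr_gt0 // => hn.
apply: le_trans e'C.
have := @cell_density_approx e' r x (q%:R ^+ n)^-1 (n + m)
  (prefix_value q u n * q ^ m + j) hr.
have -> : q%:R ^+ (n + m) * (q%:R ^+ n)^-1 = q%:R ^+ m :> R.
  by rewrite exprD mulrAC divff ?gt_eqF // mul1r.
rewrite e'0 e'1 exprD => /(_ isT).
have /andP[b1 b2] := base_value_bounds R q_gt0 n uq; rewrite -xu in b1 b2.
have a1 : (prefix_value q u n)%:R / q%:R ^+ n <=
    (prefix_value q u n * q ^ m + j)%:R / (q%:R ^+ n * q%:R ^+ m) :> R.
  rewrite ler_pdivlMr ?mulr_gt0 // mulrA divfK ?gt_eqF //.
  by rewrite -natrX -natrM ler_nat leq_addr.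
have a2 : (prefix_value q u n * q ^ m + j).+1%:R / (q%:R ^+ n * q%:R ^+ m) <=
    (prefix_value q u n).+1%:R / q%:R ^+ n :> R.
  rewrite ler_pdivrMr ?mulr_gt0 // mulrA divfK ?gt_eqF //.
  by rewrite -natrX -natrM ler_nat mulSn [leqRHS]addnC -addnS leq_add2l.
have E : (prefix_value q u n).+1%:R / q%:R ^+ n =
  (prefix_value q u n)%:R / q%:R ^+ n + (q%:R ^+ n)^-1 :> R.
  by rewrite -natr1 mulrDl mul1r.
apply; lra.
Qed.

End limit.

(** * Almost everywhere differentiability *)

(** Negligibility asks for one measurable null superset: the intersection of covers of measure at
    most [1 / n.+1]. *)
Lemma small_cover_negligible (R : realType) (A : set R) :
  (forall e : R, 0 < e -> exists B : set R, [/\ measurable B, A `<=` B &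
    (lebesgue_measure B <= e%:E)%E]) ->
  lebesgue_measure.-negligible A.
Proof.
move=> hA.
have /choice[B hB] n : exists B : set R, [/\ measurable B, A `<=` B &
    (lebesgue_measure B <= n.+1%:R^-1%:E)%E] by apply: hA; rewrite invr_gt0.
have mB : measurable (\bigcap_n B n).
  by apply: bigcapT_measurable => n; have [] := hB n.
exists (\bigcap_n B n); split => //; last by move=> x Ax n _; have [_ + _] := hB n; exact.
apply/eqP; rewrite -measure_le0; apply/lee_addgt0Pr => e e0; rewrite add0e.
have /ltW he : e^-1 < (Num.truncn e^-1).+1%:R by exact: truncnS_gt.
have [mBn _ Bn] := hB (Num.truncn e^-1).
apply: (@le_trans _ _ (lebesgue_measure (B (Num.truncn e^-1)))).
  by apply: le_measure; [exact: mem_set|exact: mem_set|exact: bigcap_inf].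
apply: (le_trans Bn); rewrite lee_fin invf_ple ?posrE //.
Qed.

(** * The distribution function minus its linear part *)

Section residual.
Context d (T : measurableType d) (R : realType) (P : probability T R).
Variables (q : nat) (X : nat -> {RV P >-> nat}).
Hypothesis q_gt1 : (1 < q)%N.
Hypothesis X_digit : forall n t, (X n t < q)%N.
Hypothesis X_stat : stationary X.
Variable c : R.
Hypothesis c_ge0 : 0 <= c.
Hypothesis c_le : forall n k, (k < q ^ n)%N -> c <= q%:R ^+ n * cell_prob q X n k.
Local Notation F := (process_cdf q X).
Let q_gt0 : (0 < q)%N. Proof. exact: ltnW. Qed.
Let qX_gt0 n : 0 < q%:R ^+ n :> R. Proof. by rewrite exprn_gt0 ?ltr0n. Qed.

Lemma process_cdf_nd : nondecreasing F.
Proof. by move=> x y xy; rewrite -subr_ge0 process_cdfB // fine_ge0. Qed.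

Lemma process_cdf_rc : right_continuous F.
Proof.
move=> x; apply: fine_cvg; rewrite fineK; first exact: cdf_right_continuous.
by rewrite fin_num_measure.
Qed.

(** Each cell inside []x, y]] has probability at least [c] times its length, and at a fine level
    these cells miss a length of at most two cells. *)
Lemma process_cdfB_ge x y : 0 <= x -> x <= y -> y <= 1 -> c * (y - x) <= F y - F x.
Proof.
move=> x0 xy y1; apply/ler_addgt0Pr => e e0.
have e2 : 0 < e / (2 * (c + 1)) by rewrite divr_gt0 // mulr_gt0 // ltr_wpDl.
have /cvgrPdist_lt /(_ _ e2) [n _ /(_ n (leqnn n))] := @cell_size_cvg0 R q q_gt1.
rewrite /= sub0r normrN gtr0_norm ?invr_gt0 //.
rewrite ltr_pdivlMr ?mulr_gt0 // ?ltr_wpDl // => hn.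
set h := (q%:R ^+ n)^-1 in hn.
have h0 : 0 < h by rewrite invr_gt0.
(* The first grid index strictly beyond [x] and the last one not beyond [y]; if [j < i], the lower
   bound is nonpositive and the sum is empty. *)
pose i := (Num.truncn (x / h)).+1; pose j := Num.truncn (y / h).
have y0 := le_trans x0 xy.
have xi : x < i%:R * h by rewrite -ltr_pdivrMr // truncnS_gt.
have ix : i%:R * h <= x + h.
  rewrite /i -natr1 mulrDl mul1r lerD2r -ler_pdivlMr //.
  by rewrite truncn_le // divr_ge0 // ltW.
have jy : j%:R * h <= y by rewrite -ler_pdivlMr // truncn_le // divr_ge0 // ltW.
have yj : y < j%:R * h + h.
  by rewrite -[X in _ + X]mul1r -mulrDl natr1 -ltr_pdivrMr // truncnS_gt.
have jq : (j <= q ^ n)%N.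
  rewrite -(ler_nat R) natrX; have := le_trans jy y1.
  by rewrite ler_pdivrMr // mul1r.
have := sum_cell_prob_le_cdfB q_gt0 X_digit jq xy xi jy.
have : c * ((j%:R - i%:R) * h) <= \sum_(i <= k < j) cell_prob q X n k.
  have [ij|ji] := leqP i j.
    rewrite -natrB // -[X in X%:R]card_ord.
    apply: (@le_trans _ _ (\sum_(i <= k < j) (c * h))).
      by rewrite sumr_const_nat card_ord -[in leRHS]mulr_natl mulrCA.
    apply: ler_sum_nat => k /andP[_ kj].
    by rewrite ler_pdivrMr // mulrC c_le // (leq_trans kj).
  rewrite big_geq ?(ltnW ji) //; rewrite mulr_ge0_le0 // mulr_le0_ge0 ?(ltW h0) //.
  by rewrite subr_le0 ler_nat ltnW.
move=> h1 h2; have {}h1 := le_trans h1 h2.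
rewrite mulrBl in h1.
have : c * (y - x - 2 * h) <= c * (j%:R * h - i%:R * h).
  by rewrite ler_wpM2l //; lra.
move=> h3; have := le_trans h3 h1; lra.
Qed.

(* Subtracting [c * unit_clamp x] rather than [c * x] keeps [residual_cdf]
   nondecreasing on all of [R], as Lebesgue-Stieltjes measures require. *)
Definition unit_clamp (x : R) : R := Num.min (Num.max x 0) 1.

Lemma unit_clamp_id x : 0 <= x -> x <= 1 -> unit_clamp x = x.
Proof. by move=> x0 x1; rewrite /unit_clamp max_l // min_l. Qed.

Definition residual_cdf (x : R) : R := F x - c * unit_clamp x.

Lemma residual_cdf_nd : nondecreasing residual_cdf.
Proof.
move=> x y xy; rewrite /residual_cdf.
suff : c * (unit_clamp y - unit_clamp x) <= F y - F x by rewrite mulrBr; lra.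
have [y0|y0] := leP y 0.
  have -> : unit_clamp y = unit_clamp x.
    by rewrite /unit_clamp !max_r // (le_trans xy).
  by rewrite subrr mulr0 subr_ge0 process_cdf_nd.
have [x1|x1] := leP 1 x.
  have -> : unit_clamp y = unit_clamp x.
    by rewrite /unit_clamp !min_r // le_max ?x1 // (le_trans x1).
  by rewrite subrr mulr0 subr_ge0 process_cdf_nd.
(* In the remaining case clamping moves both points inward, so the increment of [F] between the
   clamped points is at most that between [x] and [y]. *)
have cy : unit_clamp y <= y by rewrite /unit_clamp ge_min ge_max lexx (ltW y0).
have cx : x <= unit_clamp x by rewrite /unit_clamp le_min le_max lexx (ltW x1).
apply: (le_trans (process_cdfB_ge _ _ _)).
- by rewrite /unit_clamp le_min le_max lexx orbT ler01.
- rewrite /unit_clamp le_min !ge_min !ge_max !le_max.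
  by rewrite xy (ltW x1) ler01 lexx !orbT.
- by rewrite /unit_clamp ge_min lexx orbT.
- by apply: lerB; exact: process_cdf_nd.
Qed.

Lemma residual_cdf_rc : right_continuous residual_cdf.
Proof.
move=> x; apply: cvgB; first exact: process_cdf_rc.
apply: cvgMr; apply: cvg_within_filter.
apply: (@continuous_min R R (fun y : R => Num.max y 0) (fun=> 1) x); last exact: cvg_cst.
apply: (@continuous_max R R (fun y : R => y) (fun=> 0) x); last exact: cvg_cst.
exact: cvg_id.
Qed.

Definition residual_cumulative : cumulative R R :=
  HB.pack residual_cdf
    (isCumulative.Build R _ R residual_cdf residual_cdf_nd residual_cdf_rc).

(** The right end is trimmed by [dl] since an atom there may belong to the next cell; [c * dl]
    accounts for the linear part lost by trimming. *)
Lemma residual_cell_measure_le (n k : nat) (dl : R) :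
  (k < q ^ n)%N -> 0 < dl <= (q%:R ^+ n)^-1 ->
  (lebesgue_stieltjes_measure residual_cumulative
     `](k%:R / q%:R ^+ n)%R, (k.+1%:R / q%:R ^+ n - dl)%R]%classic <=
   (cell_prob q X n k - c / q%:R ^+ n + c * dl)%:E)%E.
Proof.
move=> kq /andP[dl0 dlq].
have a0 : 0 <= k%:R / q%:R ^+ n :> R by rewrite divr_ge0 // ltW.
have b1 : k.+1%:R / q%:R ^+ n <= 1 :> R.
  by rewrite ler_pdivrMr // mul1r -natrX ler_nat.
have abE : k.+1%:R / q%:R ^+ n = k%:R / q%:R ^+ n + (q%:R ^+ n)^-1 :> R.
  by rewrite -natr1 mulrDl mul1r.
have ab : k%:R / q%:R ^+ n <= k.+1%:R / q%:R ^+ n - dl :> R by lra.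
rewrite stieltjes_measure_ocitv // lee_fin /= /residual_cdf.
rewrite !unit_clamp_id; [|lra..].
have : F (k.+1%:R / q%:R ^+ n - dl) - F (k%:R / q%:R ^+ n) <= cell_prob q X n k.
  by apply: cdfB_le_cell_prob => //; rewrite gtrBl.
by rewrite abE; lra.
Qed.

(** The intervals straddle [x], so that [x] lies in the open interval of a steep pair. *)
Definition oscillating (eta : R) : set R := [set x | 0 < x <= 1 /\
  forall r, 0 < r -> exists s t, [/\ s < x < t, t - s < r &
    eta * (t - s) <= residual_cdf t - residual_cdf s]].

Hypothesis c_inf : forall e, 0 < e ->
  exists m j, (j < q ^ m)%N /\ q%:R ^+ m * cell_prob q X m j < c + e.

(** The uniform weights [c / q ^ n] satisfy the same splitting and shift identities as the cell
    probabilities, so the differences do too. *)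
Lemma residual_sparse_cells (e : R) : 0 < e -> exists n (B : pred nat),
  \sum_(k < q ^ n) (B k)%:R * (cell_prob q X n k - c / q%:R ^+ n) <= e /\
  \sum_(k < q ^ n) (~~ B k)%:R / q%:R ^+ n <= e.
Proof.
have qR_gt0 : 0 < q%:R :> R by rewrite ltr0n.
apply: (@sparse_cells R q (fun n k => cell_prob q X n k - c / q%:R ^+ n)) => //.
- by move=> n k kq; rewrite subr_ge0 ler_pdivrMr // mulrC c_le.
- move=> n k kq; rewrite sumrB -cell_prob_split // sumr_const card_ord.
  rewrite -(mulr_natr _ q) exprSr; congr (_ - _); field.
  by rewrite mul1r !gt_eqF.
- move=> n m j jq; rewrite sumrB -cell_prob_shift // sumr_const card_ord.
  rewrite -(mulr_natr _ (q ^ n)%N) natrX exprD; congr (_ - _); field.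
  by rewrite !gt_eqF.
- move=> e0 /c_inf [m [j [jq h]]]; exists m, j; split => //.
  by rewrite mulrBr mulrCA divff ?gt_eqF // mulr1 ltrBlDl.
Qed.

Lemma oscillating_negligible (eta : R) : 0 < eta ->
  lebesgue_measure.-negligible (oscillating eta).
Proof.
move=> eta0; apply: small_cover_negligible => e e0.
(* The cover found has measure at most [e' * K]: [3 / eta * (e' * (1 + c))] from the maximal
   inequality and [2 * e'] from [W]. *)
pose K := 3 * (1 + c) / eta + 2.
have K0 : 0 < K by rewrite ltr_wpDl // divr_ge0 ?mulr_ge0 ?addr_ge0 // ltW.
pose e' := Num.min 1 (e / K).
have e'0 : 0 < e' by rewrite lt_min ltr01 divr_gt0.
have e'1 : e' <= 1 by rewrite ge_min lexx.
have e'K : e' * K <= e by rewrite -ler_pdivlMr // ge_min lexx orbT.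
have [n [B [Br Bq]]] := residual_sparse_cells e'0.
pose a k : R := k%:R / q%:R ^+ n; pose b k : R := k.+1%:R / q%:R ^+ n.
(* Trimming all [q ^ n] cells removes total length [e']. *)
pose dl := e' / q%:R ^+ n.
have dl0 : 0 < dl by rewrite divr_gt0.
have dlq : dl <= (q%:R ^+ n)^-1 by rewrite /dl ler_piMl // invr_ge0 ltW.
have qdl : q%:R ^+ n * dl = e' by rewrite /dl mulrC divfK // gt_eqF.
have abE k : b k = a k + (q%:R ^+ n)^-1 by rewrite /a /b -natr1 mulrDl mul1r.
(* [U] consists of the trimmed cells in [B], of small residual mass; [W] contains the trimmed ends
   and the cells outside [B], of small length. *)
pose I k : set R := if B k then `]a k, b k - dl]%classic else set0.
pose J k : set R := `[if B k then b k - dl else a k, b k]%classic.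
pose U := \big[setU/set0]_(k < q ^ n) I k.
pose W := \big[setU/set0]_(k < q ^ n) J k.
have mI k : measurable (I k) by rewrite /I; case: ifP.
have mJ k : measurable (J k) by exact: measurable_itv.
have mU : measurable U by exact: bigsetU_measurable.
have mW : measurable W by exact: bigsetU_measurable.
have nuU : (lebesgue_stieltjes_measure residual_cumulative U <= (e' * (1 + c))%:E)%E.
  apply: (le_trans (@content_subadditive _ _ _
    (lebesgue_stieltjes_measure residual_cumulative) U I (q ^ n)%N _ _ _)) => //.
    by move=> k _; exact: mI.
  apply: (@le_trans _ _ (\sum_(k < q ^ n)
     ((B k)%:R * (cell_prob q X n k - c / q%:R ^+ n) + c * dl)%:E)%E).
    apply: lee_sum => k _; rewrite /I; case: (B k).
      by rewrite mul1r residual_cell_measure_le // dl0.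
    by rewrite measure0 mul0r add0r lee_fin mulr_ge0 // ltW.
  rewrite sumEFin lee_fin big_split /= sumr_const card_ord.
  rewrite -(mulr_natr _ (q ^ n)%N) natrX.
  have -> : c * dl * q%:R ^+ n = e' * c by rewrite -qdl; ring.
  by rewrite mulrDr mulr1 lerD.
have lJ k : (lebesgue_measure (J k) <= ((~~ B k)%:R / q%:R ^+ n + dl)%:E)%E.
  rewrite /J lebesgue_measure_itv /=; case: ifP => _.
    by rewrite -EFinB lee_fin; case: (B k) => /=; rewrite ?mul0r ?mul1r ?abE; lra.
  by rewrite lee_fin addr_ge0 ?divr_ge0 ?(ltW dl0) // ltW.
have lW : (lebesgue_measure W <= (2 * e')%:E)%E.
  apply: (le_trans (@content_subadditive _ _ _
    lebesgue_measure W J (q ^ n)%N _ _ _)) => //.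
    by move=> k _; exact: mJ.
  apply: (@le_trans _ _ (\sum_(k < q ^ n) ((~~ B k)%:R / q%:R ^+ n + dl)%:E)%E).
    by apply: lee_sum => k _; exact: lJ.
  rewrite sumEFin lee_fin big_split /= sumr_const card_ord.
  rewrite -(mulr_natr _ (q ^ n)%N) natrX [dl * _]mulrC qdl; lra.
exists (steep_part residual_cumulative eta U `|` W); split.
- by apply: measurableU => //; apply: open_measurable; exact: open_steep_part.
- move=> x [/andP[x0 x1] osc].
  have exk : exists k, x <= b k.
    exists (q ^ n).-1; rewrite /b prednK ?expn_gt0 ?q_gt0 // natrX divff //.
    by rewrite gt_eqF.
  (* The least such index places [x] in []a k, b k]]. *)
  pose k := ex_minn exk; have [xb kmin] : x <= b k /\ forall j, x <= b j -> (k <= j)%N.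
    by rewrite /k; case: ex_minnP.
  have kq : (k < q ^ n)%N.
    rewrite -[(q ^ n)%N]prednK ?expn_gt0 ?q_gt0 // ltnS kmin //.
    by rewrite /b prednK ?expn_gt0 ?q_gt0 // natrX divff // gt_eqF.
  have ax : a k < x.
    rewrite ltNge; apply/negP; case: (k) kmin => [_|k' kmin].
      by rewrite /a mul0r leNgt x0.
    by move=> /kmin; rewrite ltnn.
  have [xJ|xJ] := pselect (J k x).
    by right; rewrite /W -(bigcup_mkord _ J); exists k.
  left.
  have [Bk xbd] : B k /\ x < b k - dl.
    move: xJ; rewrite /J /= in_itv /= xb andbT => /negP; rewrite -ltNge.
    by case: (B k) => // h; have := lt_trans h ax; rewrite ltxx.
  (* Intervals around [x] shorter than this minimum stay in the trimmed cell, hence in [U]. *)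
  have [|s [t [/andP[sx xt] ts st]]] := osc (Num.min (x - a k) (b k - dl - x)).
    by rewrite lt_min !subr_gt0 ax.
  move: ts; rewrite lt_min => /andP[ts1 ts2].
  exists (s, t); last by rewrite /= in_itv /= sx.
  split => //=; first exact: lt_trans xt.
  move=> y; rewrite /U -(bigcup_mkord _ I) /= in_itv /= => /andP[sy yt].
  exists k => //; rewrite /I Bk /= in_itv /=; apply/andP; split; lra.
- apply: (le_trans (measureU2 _ _ _)) => //.
    apply: open_measurable; exact: open_steep_part.
  apply: (@le_trans _ _ ((3 / eta * (e' * (1 + c)))%:E + (2 * e')%:E)%E).
    apply: leeD => //.
    have := steep_part_le residual_cumulative eta0 mU.
    rewrite -lee_pdivlMl // => h; apply: (le_trans h).
    rewrite -mulrA mulrCA EFinM lee_wpmul2l ?lee_fin ?invr_ge0 ?(ltW eta0) //.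
    by rewrite EFinM lee_wpmul2l ?lee_fin.
  rewrite -EFinD lee_fin; apply: le_trans e'K.
  by rewrite /K le_eqVlt; apply/orP; left; apply/eqP; field; rewrite gt_eqF.
Qed.

End residual.

Section derivative.
Context d (T : measurableType d) (R : realType) (P : probability T R).
Variables (q : nat) (X : nat -> {RV P >-> nat}).
Hypothesis q_gt1 : (1 < q)%N.
Hypothesis X_digit : forall n t, (X n t < q)%N.
Variable c : R.
Hypothesis c_ge0 : 0 <= c.
Hypothesis c_le : forall n k, (k < q ^ n)%N -> c <= q%:R ^+ n * cell_prob q X n k.
Local Notation F := (process_cdf q X).
Local Notation H := (residual_cdf q X c).

(** Since [H] is nondecreasing, its one-sided increment from [x] to [x + h] is dominated by its
    increment over the symmetric interval of radius [|h|], which is below [eta * (2 * |h|)]. *)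
Lemma process_cdf_derive1 (x : R) : 0 < x < 1 ->
  (forall i : nat, ~ oscillating q X c i.+1%:R^-1 x) ->
  derivable F x 1 /\ derive1 F x = c.
Proof.
move=> /andP[x0 x1] nosc.
suff cv : h^-1 *: (F (h *: 1 + x) - F x) @[h --> 0^'] --> c.
  by split; [apply/cvg_ex; exists c|rewrite derive1E; exact: cvg_lim].
under eq_fun do rewrite scaler1.
apply/cvgrPdist_le => e e0.
have [i ie] : exists i : nat, i.+1%:R^-1 <= e / 2.
  exists (Num.truncn (e / 2)^-1); rewrite invf_ple ?posrE ?divr_gt0 //.
  by rewrite ltW // truncnS_gt.
set eta := i.+1%:R^-1 in ie.
have eta0 : 0 < eta by rewrite invr_gt0.
have [r r0 hr] : exists2 r : R, 0 < r & forall s t, s < x < t -> t - s < r ->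
    H t - H s < eta * (t - s).
  apply: contrapT => no; apply: (nosc i); split; first by rewrite x0 ltW.
  move=> r r0; apply: contrapT => no'; apply: no; exists r => // s t sxt tsr.
  by rewrite ltNge; apply/negP => le; apply: no'; exists s, t.
have Hnd : nondecreasing H by exact: residual_cdf_nd.
(* The symmetric interval has length [2 * |h|], which must be below [r]; the other bounds keep it in
   [[0, 1]], where the clamp is the identity. *)
pose m := Num.min (r / 2) (Num.min x (1 - x)).
have m0 : 0 < m by rewrite !lt_min divr_gt0 // x0 subr_gt0.
exists m => // h; rewrite /= sub0r normrN => hm h0.
have a0 : 0 < `|h| by rewrite normr_gt0.
move: hm; rewrite !lt_min => /and3P[hr' hx hx1].
have sym : H (x + `|h|) - H (x - `|h|) < eta * (2 * `|h|).
  have -> : 2 * `|h| = x + `|h| - (x - `|h|) by ring.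
  apply: hr; lra.
have hh : - `|h| <= h <= `|h| by rewrite -ler_norml.
have h1 : H (h + x) <= H (x + `|h|) by apply: Hnd; lra.
have h2 : H (x - `|h|) <= H (h + x) by apply: Hnd; lra.
have h3 : H x <= H (x + `|h|) by apply: Hnd; lra.
have h4 : H (x - `|h|) <= H x by apply: Hnd; lra.
have HE y : 0 <= y -> y <= 1 -> F y = H y + c * y.
  by move=> y0 y1; rewrite /residual_cdf unit_clamp_id // subrK.
rewrite !HE ?(ltW x0) ?(ltW x1) //; [|lra..].
have -> : h^-1 *: (H (h + x) + c * (h + x) - (H x + c * x)) =
    h^-1 * (H (h + x) - H x) + c by rewrite /GRing.scale /=; field.
rewrite opprD addrC subrK normrN normrM normfV ler_pdivrMl //.
have : eta * (2 * `|h|) <= `|h| * e.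
  have := ler_wpM2r (ltW a0) ie; lra.
rewrite ler_norml; lra.
Qed.

End derivative.

Theorem proposition2p3 (d : measure_display) (T : measurableType d)
    (R : realType) (P : probability T R) (q : nat)
    (X : nat -> {RV P >-> nat})
    (q_ge2 : (2 <= q)%N)
    (X_digit : forall (n : nat) (t : T), (X n t < q)%N)
    (X_stat : stationary X) :
  let F : R -> R := process_cdf q X in
  (exists c : R, 0 <= c <= 1 /\
     {ae lebesgue_measure, forall x : R, 0 <= x <= 1 ->
        derivable F x 1 /\ derive1 F x = c}) /\
  (forall (x : R) (u : nat -> nat),
     0 <= x <= 1 -> ~ base_fractions q x ->
     (forall n : nat, (u n < q)%N) -> x = base_value R q u ->
     derivable F x 1 ->
     forall (m : nat) (xi : m.-tuple nat), all (fun a => (a < q)%N) xi ->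
       (q%:R ^+ (n + m) * word_prob X (mkseq u n ++ xi)) @[n --> \oo]
         --> derive1 F x).
Proof.
move=> F; have q0 : (0 < q)%N by exact: ltnW.
split; last first.
  move=> x u _ _ uq xu dF m xi xiq.
  have xi_lt i : (nth 0 xi i < q)%N.
    case: (ltnP i (size xi)) => [|h]; first exact: (all_nthP 0%N xiq).
    by rewrite nth_default.
  have := cell_density_cvg q_ge2 X_digit uq xu (prefix_value_lt m xi_lt) dF.
  apply: cvg_trans; apply: near_eq_cvg; apply: nearW => n /=.
  have wq : all (fun a => (a < q)%N) (mkseq u n ++ xi).
    rewrite all_cat xiq andbT; apply/allP => _ /mapP[i _ ->]; exact: uq.
  rewrite (word_probE q0 X_digit wq) size_cat size_mkseq size_tuple.
  congr (_ * cell_prob q X _ _); rewrite prefix_valueD.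
  have -> : (fun i => nth 0%N (mkseq u n ++ xi) (n + i)%N) = nth 0%N xi.
    apply/funext => i; rewrite nth_cat size_mkseq -{2}[n]addn0 ltn_add2l ltn0.
    by rewrite addKn.
  congr (_ * _ + _)%N.
  suff E k : (k <= n)%N -> prefix_value q u k =
      prefix_value q (nth 0%N (mkseq u n ++ xi)) k by exact: E.
  elim: k => [//|k IH] kn /=; rewrite IH ?(ltnW kn) //.
  by rewrite nth_cat size_mkseq kn nth_mkseq.
(* The set of cell densities. The single cell of level 0 has density 1, whence [c <= 1]. *)
pose D := [set z : R | exists n k, (k < q ^ n)%N /\ z = q%:R ^+ n * cell_prob q X n k].
have D0 : lbound D 0.
  by move=> _ [n [k [_ ->]]]; rewrite mulr_ge0 ?exprn_ge0 ?ler0n ?cell_prob_ge0.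
have D1 : D 1 by exists 0%N, 0%N; rewrite cell_prob00 mulr1 expr0.
have Dinf : has_inf D by split; [exists 1|exists 0].
pose c := inf D.
have c0 : 0 <= c by apply: lb_le_inf => //; exists 1.
have c1 : c <= 1 by apply: ge_inf => //; exists 0.
have c_le n k : (k < q ^ n)%N -> c <= q%:R ^+ n * cell_prob q X n k.
  by move=> kq; apply: ge_inf; [exists 0|exists n, k].
have c_inf e : 0 < e ->
    exists m j, (j < q ^ m)%N /\ q%:R ^+ m * cell_prob q X m j < c + e.
  move=> e0; have [_ [m [j [jq ->]]] h] := inf_adherent e0 Dinf.
  by exists m, j.
exists c; split; first by rewrite c0 c1.
(* [process_cdf_derive1] treats interior points only, so the two endpoints join the exceptional set;
   the thresholds [1 / i.+1] make the union countable. *)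
pose N := [set 0; 1] `|` \bigcup_i oscillating q X c i.+1%:R^-1.
have sub : ~` [set x | 0 <= x <= 1 -> derivable F x 1 /\ derive1 F x = c] `<=` N.
  move=> x /= hx; apply: contrapT => nN; apply: hx => /andP[x0 x1].
  apply: (process_cdf_derive1 q_ge2 X_digit c0 c_le).
    rewrite !lt_neqAle x0 x1 !andbT; apply/andP; split; apply/eqP => xE; apply: nN; left.
      by left; rewrite xE.
    by right.
  by move=> i o; apply: nN; right; exists i.
have [A [mA A0 NA]] : lebesgue_measure.-negligible N.
  apply: negligibleU; last first.
    apply: negligible_bigcup => i.
    apply: (oscillating_negligible q_ge2 X_digit X_stat c0 c_le c_inf).
    by rewrite invr_gt0.
  apply/negligibleP; first exact: measurableU.
  by apply: countable_lebesgue_measure0; apply: finite_set_countable.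
by exists A; split => //; exact: subset_trans NA.
Qed.
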